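(* Let $G=(V,E)$ be a graph admitting a near $\alpha$-valuation $p$, and let $l$ be a positive integer. Then there exists an $(|E|l^2+1,\,|V|,\,l,\,1;\,G^p)$-EDF in $\mathbb{Z}_{|E|l^2+1}$.
   Context: A $\beta$-valuation of a graph $G$ with $n$ edges is an injective $b:V(G)\to\{0,\ldots,n\}$ with $\{|b(u)-b(v)|:\{u,v\}\in E(G)\}=\{1,\ldots,n\}$ as multisets. A near $\alpha$-valuation is a $\beta$-valuation $b$ with a partition $V(G)=V_{small}\cup V_{large}$ such that each vertex of $V_{small}$ has label smaller than all its neighbours' labels and each vertex of $V_{large}$ has label larger than all its neighbours' labels. For a vertex labelling $b$ of $G$, the natural orientation $G^b$ is the digraph obtained by orienting each edge towards the endpoint with the larger label. $\Delta(A,B)$ denotes the multiset $\{a-b: a\in A, b\in B\}$. For a group $\Gamma$ of order $n$ and a digraph $H$ with $m$ vertices and arc set $\overrightarrow{E}(H)$, a family $(A_v)_{v\in V(H)}$ of pairwise disjoint $l$-subsets of $\Gamma$ is an $(n,m,l,\lambda;H)$-EDF if $\bigcup_{(u,v)\in\overrightarrow{E}(H)}\Delta(A_v,A_u)=\lambda(\Gamma\setminus\{0\})$ as multisets.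
   Formalization: The formal statement assumes that G has at least one edge or l = 1; without this the claim fails for the one-vertex graph with no edges and l ≥ 2, since Z_1 has no l-subset. *)

(* Defs.v *)
From HB Require Import structures.
From mathcomp Require Import all_boot all_order all_algebra.
Set Implicit Arguments.
Unset Strict Implicit.
Unset Printing Implicit Defensive.
Import GRing.Theory.

(* A finite simple graph on V is a symmetric irreflexive relation on V, a
   digraph is an arbitrary relation on V.  Multisets are sequences, compared
   up to perm_eq. *)

Definition edges (V : finType) (e : rel V) : {set {set V}} :=
  [set [set xy.1; xy.2] | xy : V * V & e xy.1 xy.2].

(* Spread of the labels on E, i.e. |b(u) - b(v)| when E = {u, v}: see
   edge_diffE. *)
Definition edge_diff (V : finType) (b : V -> nat) (E : {set V}) : nat :=
  \max_(u in E) \max_(v in E) `|b u - b v|%N.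

Lemma edge_diffE (V : finType) (b : V -> nat) (u v : V) :
  edge_diff b [set u; v] = `|b u - b v|%N.
Proof.
apply/eqP; rewrite eqn_leq; apply/andP; split.
  apply/bigmax_leqP => x; rewrite !inE => Hx.
  apply/bigmax_leqP => y; rewrite !inE => Hy.
  case/orP: Hx => /eqP->; case/orP: Hy => /eqP->;
    by rewrite ?subrr // distnC.
apply: leq_trans (@leq_bigmax_cond _ _
  (fun x => \max_(y in [set u; v]) `|b x - b y|%N) u (set21 u v)).
exact: (@leq_bigmax_cond _ _ (fun y => `|b u - b y|%N) v (set22 u v)).
Qed.

Definition beta_valuation (V : finType) (e : rel V) (b : V -> nat) : Prop :=
  [/\ injective b,
      forall v, b v <= #|edges e| &
      perm_eq [seq edge_diff b E | E <- enum (edges e)] (iota 1 #|edges e|)].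

Definition near_alpha_valuation (V : finType) (e : rel V) (b : V -> nat) :
    Prop :=
  beta_valuation e b /\
  exists Vsmall Vlarge : {set V},
    [/\ Vsmall :|: Vlarge = [set: V],
        [disjoint Vsmall & Vlarge],
        forall u v, u \in Vsmall -> e u v -> b u < b v &
        forall u v, u \in Vlarge -> e u v -> b v < b u].

Definition natural_orientation (V : finType) (e : rel V) (b : V -> nat) :
    rel V :=
  [rel u v | e u v && (b u < b v)].

Definition Delta (Gamma : finZmodType) (A B : {set Gamma}) : seq Gamma :=
  [seq (x - y)%R | x <- enum A, y <- enum B].

(* An (n, m, l, lambda; h)-EDF in Gamma.  An arc (u, v), from u to v,
   contributes Delta (A v) (A u). *)
Definition digraph_EDF (n m l lambda : nat) (Gamma : finZmodType)
    (W : finType) (h : rel W) (A : W -> {set Gamma}) : Prop :=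
  [/\ #|Gamma| = n,
      #|W| = m,
      forall v, #|A v| = l,
      forall u v, u != v -> [disjoint A u & A v] &
      perm_eq
        (flatten [seq Delta (A uv.2) (A uv.1)
                 | uv <- enum [pred uv : W * W | h uv.1 uv.2]])
        (flatten (nseq lambda (enum [set~ (0 : Gamma)%R])))].

(* Main.v *)
Require Import Defs.
From mathcomp Require Import all_boot all_order all_algebra.
From mathcomp Require Import zify.
Import ssrint.IntDist.

Set Implicit Arguments.
Unset Strict Implicit.
Unset Printing Implicit Defensive.

(** Blow up each vertex label [p v] by [l ^ 2]: a small vertex receives the
    interval [p v * l ^ 2 + i] and a large one the progression
    [p v * l ^ 2 - j * l], for [i, j < l].  Every arc goes from a small vertex
    to a large one, so an arc whose labels differ by [d] contributes
    [d * l ^ 2 - (j * l + i)], that is, writing numbers below [l ^ 2] in base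
    [l], each integer [k] with [(d - 1) * l ^ 2 < k <= d * l ^ 2] exactly once.  As [d]
    runs over [1, ..., |E|], every nonzero residue is obtained; since there are
    only [|E| * l ^ 2] differences, each is obtained once. *)

(** No wrap-around occurs for such [a] and [b], so differences in the cyclic group can be computed
    in [nat]. *)
Lemma inordB (m a b : nat) :
  b <= a -> a <= m -> (inord a - inord b)%R = inord (a - b) :> 'I_m.+1.
Proof.
move=> ba am; apply/eqP; rewrite GRing.subr_eq; apply/eqP/val_inj => /=.
by rewrite !inordK ?ltnS ?subnK ?modn_small //; lia.
Qed.

Lemma inord_inj_le (m a b : nat) :
  a <= m -> b <= m -> inord a = inord b :> 'I_m.+1 -> a = b.
Proof. by move=> am bm /(congr1 val) /=; rewrite !inordK. Qed.

Lemma size_Delta (Gamma : finZmodType) (A B : {set Gamma}) :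
  size (Delta A B) = #|A| * #|B|.
Proof. by rewrite size_allpairs -!cardE. Qed.

Lemma size_flatten_const (T : eqType) (S : Type) (f : T -> seq S) (s : seq T)
    (c : nat) :
  {in s, forall x, size (f x) = c} ->
  size (flatten [seq f x | x <- s]) = size s * c.
Proof.
elim: s => //= x s IH fs; rewrite size_cat fs ?mem_head // IH ?mulSn //.
by move=> y ys; rewrite fs // inE ys orbT.
Qed.

(** The labels order the two ends of an edge, so an arc is recovered from its underlying pair. *)
Lemma natural_orientation_card (V : finType) (e : rel V) (p : V -> nat) :
  #|[pred uv : V * V | natural_orientation e p uv.1 uv.2]| <= #|edges e|.
Proof.
pose f (uv : V * V) := [set uv.1; uv.2].
rewrite -(@card_in_imset _ _ f); last first.
  move=> [u v] [x y]; rewrite !inE /= => /andP[_ uv] /andP[_ xy] /setP fE.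
  have := fE u; have := fE v; rewrite !inE /= !eqxx /= orbT.
  by move=> /esym/orP[] /eqP vE /esym/orP[] /eqP uE; subst=> //; exfalso; lia.
apply: subset_leq_card; apply/subsetP => E /imsetP[[u v]].
by rewrite inE => /andP[uv _] ->; apply/imsetP; exists (u, v); rewrite ?inE.
Qed.

Lemma beta_valuation_arc (V : finType) (e : rel V) (p : V -> nat) (d : nat) :
  symmetric e -> beta_valuation e p -> 0 < d -> d <= #|edges e| ->
  exists u v, e u v /\ p v = p u + d.
Proof.
move=> e_sym [_ _ /perm_mem diffs] d0 dn.
have := diffs d; rewrite mem_iota add1n ltnS d0 dn /= => /mapP[E].
rewrite mem_enum => /imsetP[[x y]]; rewrite inE /= => exy ->.
rewrite edge_diffE => dE.
case: (leqP (p x) (p y)) => xy.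
  by exists x, y; rewrite dE distnEr ?subnKC.
by exists y, x; rewrite e_sym dE distnEl ?subnKC ?(ltnW xy).
Qed.

Definition blowup (V : finType) (S : {set V}) (p : V -> nat) (l : nat)
    (v : V) (i : nat) : nat :=
  if v \in S then p v * l ^ 2 + i else p v * l ^ 2 - i * l.

Section Blowup.

Variables (V : finType) (e : rel V) (p : V -> nat) (S : {set V}) (l : nat).
Hypotheses (e_sym : symmetric e) (p_beta : beta_valuation e p).
Hypothesis S_small : forall u v, u \in S -> e u v -> p u < p v.
Hypothesis S_large : forall u v, u \notin S -> e u v -> p v < p u.
Hypothesis l_gt0 : 0 < l.
(** Without edges the group is trivial, and a vertex can receive an [l]-subset of it only if
    [l = 1]. *)
Hypothesis nondegenerate : 0 < #|edges e| \/ l = 1.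

(* The vertices labelled [0] and [|E|] are joined by the edge of difference
   [|E|], so the former is small and the latter large. *)
Lemma small_lt_card (v : V) :
  0 < #|edges e| -> v \in S -> p v < #|edges e|.
Proof.
move=> n0 vS; have [p_inj p_le _] := p_beta.
have [x [y [exy pE]]] := beta_valuation_arc e_sym p_beta n0 (leqnn _).
have := p_le v; rewrite leq_eqVlt => /orP[/eqP pv|//].
have /p_inj vy : p v = p y by have := p_le y; lia.
have : p v < p x by apply: S_small => //; rewrite vy e_sym.
by have := p_le y; rewrite vy; lia.
Qed.

Lemma large_gt0 (v : V) : 0 < #|edges e| -> v \notin S -> 0 < p v.
Proof.
move=> n0 vS; have [p_inj p_le _] := p_beta.
have [x [y [exy pE]]] := beta_valuation_arc e_sym p_beta n0 (leqnn _).
rewrite lt0n; apply/eqP => pv.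
have /p_inj vx : p v = p x by have := p_le y; lia.
by have : p y < p v; [apply: S_large => //; rewrite vx | lia].
Qed.

Lemma blowup_le (v : V) (i : nat) :
  i < l -> blowup S p l v i <= #|edges e| * l ^ 2.
Proof.
move=> il; have [_ /(_ v) p_le _] := p_beta; rewrite /blowup.
case: ifPn => vS; last by nia.
case: (posnP #|edges e|) => [n0|n0]; last first.
  by have := small_lt_card n0 vS; nia.
by case: nondegenerate => [|l1]; nia.
Qed.

(** Ensures that the subtraction in [blowup] is never truncated: a large vertex has a positive
    label, and [i * l < l ^ 2]. *)
Lemma blowup_largeK (v : V) (i : nat) :
  v \notin S -> i < l -> i * l <= p v * l ^ 2.
Proof.
move=> vS il; case: (posnP #|edges e|) => [n0|n0]; last first.
  by have := large_gt0 n0 vS; nia.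
by case: nondegenerate => [|l1]; nia.
Qed.

(** Two offsets on the same side differ by less than [l ^ 2]. For vertices on opposite sides the
    offsets add up to some [i + j * l < l ^ 2]. Either way the labels agree, which for opposite
    sides is absurd. *)
Lemma blowup_inj (u v : V) (i j : nat) :
  i < l -> j < l -> blowup S p l u i = blowup S p l v j -> u = v /\ i = j.
Proof.
move=> il jl; have [p_inj _ _] := p_beta; rewrite /blowup.
have l2 : l ^ 2 = l * l by rewrite expnS expn1.
case: ifPn => uS; case: ifPn => vS;
  rewrite ?l2; try have := blowup_largeK uS il; try have := blowup_largeK vS jl;
  rewrite ?l2 => *.
- have puv : p u = p v by nia.
  by split; [exact: p_inj | nia].
- have puv : p u = p v by nia.
  by move: vS; rewrite -(p_inj _ _ puv) uS.
- have puv : p u = p v by nia.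
  by move: uS; rewrite (p_inj _ _ puv) vS.
- have puv : p u = p v by nia.
  by split; [exact: p_inj | nia].
Qed.

(* The base-[l] digits of [d * l ^ 2 - k], where [d] is [k / l ^ 2] rounded
   up, are the indices of the two elements with difference [k]. *)
Lemma blowup_diff (k : nat) :
  0 < k -> k <= #|edges e| * l ^ 2 ->
  exists u v i j, [/\ e u v /\ p u < p v, i < l, j < l,
    blowup S p l u i <= blowup S p l v j &
    blowup S p l v j - blowup S p l u i = k].
Proof.
move=> k0 kn; have l20 : 0 < l ^ 2 by rewrite expn_gt0 l_gt0.
(* Dividing [k.-1] instead of [k] rounds up, so a multiple of [l ^ 2] gives [r = 0] and always
   [r < l ^ 2]. *)
pose q := k.-1 %/ l ^ 2; pose r := q.+1 * l ^ 2 - k.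
have kE : k.-1 = q * l ^ 2 + k.-1 %% l ^ 2 by exact: divn_eq.
have kl := ltn_pmod k.-1 l20.
have rk : r + k = q.+1 * l ^ 2 by rewrite /r; nia.
have rl : r < l ^ 2 by nia.
have qn : q.+1 <= #|edges e| by nia.
have [u [v [euv puv]]] := beta_valuation_arc e_sym p_beta (ltn0Sn q) qn.
have uS : u \in S.
  by apply/negP => /negP uS; have := S_large uS euv; lia.
have vS : v \notin S.
  by apply/negP => vS; have := S_small vS (etrans (e_sym v u) euv); lia.
have jl : r %/ l < l by rewrite ltn_divLR // -expnSr.
have il : r %% l < l by rewrite ltn_pmod.
have := divn_eq r l; have := blowup_largeK vS jl.
exists u, v, (r %% l), (r %/ l); rewrite /blowup uS (negbTE vS) puv mulnDl.
split=> //; [split=> // | |]; lia.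
Qed.

End Blowup.

Theorem theorem4p7 (V : finType) (e : rel V)
    (e_sym : symmetric e) (e_irr : irreflexive e)
    (p : V -> nat) (hp : near_alpha_valuation e p)
    (l : nat) (l_gt0 : 0 < l)
    (nondegenerate : 0 < #|edges e| \/ l = 1) :
  exists A : V -> {set 'I_(#|edges e| * l ^ 2).+1},
    digraph_EDF (#|edges e| * l ^ 2 + 1) #|V| l 1
      (natural_orientation e p) A.
Proof.
have [p_beta [S [L [SL _ S_small L_large]]]] := hp.
have S_large u v : u \notin S -> e u v -> p v < p u.
  move=> uS; apply: L_large.
  by have := in_setT u; rewrite -SL inE (negbTE uS).
have b_le v (i : 'I_l) : blowup S p l v i <= #|edges e| * l ^ 2.
  exact: (@blowup_le _ e).
have b_inj u v (i j : 'I_l) :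
    blowup S p l u i = blowup S p l v j -> u = v /\ i = j.
  by move=> /(@blowup_inj _ e) [] // -> /val_inj.
pose A v : {set 'I_(#|edges e| * l ^ 2).+1} :=
  [set inord (blowup S p l v i) | i : 'I_l].
have cardA v : #|A v| = l.
  rewrite card_imset ?card_ord // => i j.
  by move=> /(inord_inj_le (b_le _ _) (b_le _ _)) /b_inj [].
exists A; split=> //; first by rewrite card_ord addn1.
  move=> u v uv; rewrite -setI_eq0; apply/eqP/setP => x; rewrite !inE.
  apply/negP => /andP[/imsetP[i _ ->] /imsetP[j _]].
  move=> /(inord_inj_le (b_le _ _) (b_le _ _)) /b_inj [] uvE.
  by rewrite uvE eqxx in uv.
rewrite /= cats0 perm_sym.
set D := flatten _; set Z := enum _.
have sub : {subset Z <= D}.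
  move=> x; rewrite mem_enum !inE => x0.
  (* The nonzero residue [x] is read as an integer from 1 to [#|edges e| * l ^ 2]. *)
  have [||u [v [i [j [[euv puv] il jl le_b diff_b]]]]] :=
    @blowup_diff _ e p S l e_sym p_beta S_small S_large l_gt0 nondegenerate x.
  - by rewrite lt0n.
  - by rewrite -ltnS ltn_ord.
  apply/flattenP; exists (Delta (A v) (A u)).
    by apply/mapP; exists (u, v); rewrite // mem_enum; apply/andP.
  apply/allpairsP; exists (inord (blowup S p l v j), inord (blowup S p l u i)).
  split; rewrite /= ?mem_enum.
  - by apply/imsetP; exists (Ordinal jl).
  - by apply/imsetP; exists (Ordinal il).
  - by rewrite inordB ?diff_b ?inord_val //; exact: (b_le v (Ordinal jl)).
have sizeD : size D <= size Z.
  rewrite (@size_flatten_const _ _ _ _ (l * l)) => [|uv _]; last first.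
    by rewrite size_Delta !cardA.
  rewrite -!cardE cardsC1 card_ord /= mulnn leq_mul2r.
  by rewrite natural_orientation_card orbT.
(* A list that covers a duplicate-free list and is no longer than it is a permutation of it. *)
have Z_uniq : uniq Z by exact: enum_uniq.
apply: uniq_perm => //; first exact: leq_size_uniq Z_uniq sub sizeD.
by have [] := uniq_min_size Z_uniq sub sizeD.
Qed.
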